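(* Let $\Pi=(\Pi_n)$ be an exchangeable Gibbs partition EGP$(\alpha,V)$ for some $\alpha\in(-\infty,1)$ and $V=(V_{n,k}:k\le n=1,2,\ldots)$. For each $n$, the conditional distribution of the age-ordered sample frequencies $\mathbf{n}=(n_1,\ldots,n_k)$ of $\Pi_n$, given the vector $\mathbf{i}_n=(i_1,\ldots,i_k)$ of record indices of $\Pi_n$, is independent of $V$ and is equal to $$\bar\mu_\alpha(\mathbf{n}\mid\mathbf{i}_n)=\psi_{\alpha,n,k}(\mathbf{i}_n)\left(\prod_{j=1}^{k}\binom{S_j-i_j}{n_j-1}(1-\alpha)_{(n_j-1)}\right)$$ for all $\mathbf{n}$ compatible with $\mathbf{i}_n$, where $S_j=\sum_{i=1}^{j}n_i$ and $$\psi_{\alpha,n,k}(\mathbf{i}_n)=\frac{\Gamma(1-\alpha)}{\Gamma(n-\alpha k)}\prod_{j=2}^{k}\frac{\Gamma(i_j-j\alpha)}{\Gamma(i_j-j\alpha-(1-\alpha))}.$$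
   Context: Notation: $a_{(x)}=\Gamma(a+x)/\Gamma(a)$ (so $a_{(0)}=1$ and $a_{(r)}=a(a+1)\cdots(a+r-1)$ for positive integers $r$). A random partition of $[n]=\{1,\ldots,n\}$ is written $\Pi_n=(\Pi_{n1},\ldots,\Pi_{nk})$ with classes ordered by their least elements $1=i_1<i_2<\cdots<i_k\le n$; these are the record indices of $\Pi_n$. The age-ordered frequencies are $\mathbf{n}=(n_1,\ldots,n_k)$, $n_j=|\Pi_{nj}|$. A vector $\mathbf{n}$ of positive integers is compatible with $\mathbf{i}_n$ if $\sum_{i=1}^k n_i=n$ and $S_{j-1}\ge i_j-1$ for $j=1,\ldots,k$ (with $S_0=0$). Let $\alpha\in(-\infty,1]$ and let $V=(V_{n,k}:1\le k\le n)$ be nonnegative coefficients with $V_{1,1}=1$ and $V_{n,k}=(n-\alpha k)V_{n+1,k}+V_{n+1,k+1}$. The exchangeable Gibbs partition EGP$(\alpha,V)$ is the random partition $\Pi=(\Pi_n)$ of $\mathbb{N}$ generated by: $\Pi_1=(\{1\})$; for $n\ge1$, given $\Pi_n=(\pi_{n1},\ldots,\pi_{nk})$ with class sizes $n_j=|\pi_{nj}|$, the element $n+1$ starts a new class with probability $V_{n+1,k+1}/V_{n,k}$, and joins the class $\pi_{nj}$ with probability $\frac{n_j-\alpha}{n-\alpha k}\left(1-\frac{V_{n+1,k+1}}{V_{n,k}}\right)$, $j=1,\ldots,k$. Conditional statements are for $\mathbf{i}_n$ of positive probability. *)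

(* Defs.v *)
From mathcomp Require Import all_boot all_order all_algebra finmap.
From mathcomp Require Import all_classical all_reals all_analysis.

Set Implicit Arguments.
Unset Strict Implicit.
Unset Printing Implicit Defensive.

Import Order.TTheory GRing.Theory Num.Theory.
Import numFieldNormedType.Exports.

Local Open Scope classical_set_scope.
Local Open Scope ring_scope.

(* Euler's integral; only meaningful (finite and positive) for [0 < x]. *)
Definition Gamma (R : realType) (x : R) : R :=
  \int[lebesgue_measure]_(t in `]0, +oo[%classic) (t `^ (x - 1) * expR (- t)).

(* a_(x) = Gamma(a + x) / Gamma(a) *)
Definition rising (R : realType) (a x : R) : R := Gamma (a + x) / Gamma a.

(* [entry s j] is the j-th entry of [s], counting from 1; to be used only for
   [1 <= j <= size s]. *)
Definition entry (s : seq nat) (j : nat) : nat := nth 0%N s j.-1.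

(* S_j = n_1 + ... + n_j, with S_0 = 0 *)
Definition psum (s : seq nat) (j : nat) : nat :=
  (\sum_(1 <= l < j.+1) entry s l)%N.

Definition least (B : {fset nat}) : nat := head 0%N (sort leq (enum_fset B)).

(* [s] lists the classes of a partition of {1, ..., n} in the order of their
   least elements. *)
Definition ordered_partition (n : nat) (s : seq {fset nat}) : Prop :=
  [/\ forall B, B \in s -> B != fset0,
      pairwise (fun A B => fdisjoint A B) s,
      forall x, has (fun B : {fset nat} => x \in B) s = (1 <= x <= n)%N
    & sorted ltn (map least s)].

Definition record_indices (s : seq {fset nat}) : seq nat := map least s.

Definition frequencies (s : seq {fset nat}) : seq nat :=
  map (fun B : {fset nat} => #|` B|) s.

Definition new_class (s : seq {fset nat}) (x : nat) : seq {fset nat} :=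
  rcons s [fset x]%fset.

(* Here classes are counted from 0, [j < size s]. *)
Definition join_class (s : seq {fset nat}) (j x : nat) : seq {fset nat} :=
  set_nth fset0 s j (x |` nth fset0 s j)%fset.

Definition cond_prob (d : measure_display) (T : measurableType d)
    (R : realType) (P : probability T R) (A B : set T) : R :=
  fine (P (A `&` B)) / fine (P B).

Definition gibbs_coefficients (R : realType) (alpha : R) (V : nat -> nat -> R)
    : Prop :=
  [/\ V 1%N 1%N = 1,
      forall n k : nat, (1 <= k <= n)%N -> 0 <= V n k
    & forall n k : nat, (1 <= k <= n)%N ->
        V n k = (n%:R - alpha * k%:R) * V n.+1 k + V n.+1 k.+1].

(* [Pi n] is the random partition of {1, ..., n}, for [1 <= n]; [Pi 0] is
   irrelevant.  The condition at [n = 1] forces [Pi 1 w] to be the partition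
   ({1}).  The transition rules only ever add [n.+1] to the value of [Pi n] and
   their probabilities sum to 1, so almost surely [Pi n.+1] restricts to
   [Pi n]; hence conditioning on [Pi n] is the same as conditioning on
   [Pi 1, ..., Pi n]. *)
Record EGP (d : measure_display) (T : measurableType d) (R : realType)
    (P : probability T R) (alpha : R) (V : nat -> nat -> R)
    (Pi : nat -> T -> seq {fset nat}) : Prop := {
  EGP_coefficients : gibbs_coefficients alpha V;
  EGP_partition : forall (n : nat) (w : T),
    (1 <= n)%N -> ordered_partition n (Pi n w);
  EGP_measurable : forall (n : nat) (s : seq {fset nat}),
    (1 <= n)%N -> measurable [set w | Pi n w = s];
  EGP_new : forall (n : nat) (s : seq {fset nat}),
    (1 <= n)%N -> (0 < P [set w | Pi n w = s])%E ->
    cond_prob P [set w | Pi n.+1 w = new_class s n.+1] [set w | Pi n w = s]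
    = V n.+1 (size s).+1 / V n (size s);
  EGP_join : forall (n : nat) (s : seq {fset nat}) (j : nat),
    (1 <= n)%N -> (0 < P [set w | Pi n w = s])%E -> (j < size s)%N ->
    cond_prob P [set w | Pi n.+1 w = join_class s j n.+1] [set w | Pi n w = s]
    = ((#|` nth fset0 s j|)%:R - alpha) / (n%:R - alpha * (size s)%:R)
      * (1 - V n.+1 (size s).+1 / V n (size s))
}.

(* The vector [nn] of class sizes is compatible with the record indices [i]. *)
Definition compatible (n : nat) (i nn : seq nat) : Prop :=
  [/\ size nn = size i,
      forall j, (1 <= j <= size i)%N -> (0 < entry nn j)%N,
      psum nn (size i) = n
    & forall j, (1 <= j <= size i)%N ->
        (entry i j - 1 <= psum nn j.-1)%N].

Definition psi (R : realType) (alpha : R) (n k : nat) (i : seq nat) : R :=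
  Gamma (1 - alpha) / Gamma (n%:R - alpha * k%:R) *
  \prod_(2 <= j < k.+1)
    (Gamma ((entry i j)%:R - j%:R * alpha) /
     Gamma ((entry i j)%:R - j%:R * alpha - (1 - alpha))).

Definition mu_bar (R : realType) (alpha : R) (n : nat) (nn i : seq nat) : R :=
  let k := size i in
  psi alpha n k i *
  \prod_(1 <= j < k.+1)
    ('C(psum nn j - entry i j, entry nn j - 1)%:R *
     rising (1 - alpha) (entry nn j - 1)%:R).

(* Main.v *)
Require Import Defs.
From mathcomp Require Import all_boot all_order all_algebra finmap.
From mathcomp Require Import all_classical all_reals all_analysis.
From mathcomp Require Import measurable_realfun ring lra zify.

Set Implicit Arguments.
Unset Strict Implicit.
Unset Printing Implicit Defensive.

Import Order.TTheory GRing.Theory Num.Theory.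
Import numFieldNormedType.Exports.

Local Open Scope classical_set_scope.
Local Open Scope ring_scope.

(* The probability of a state s of Pi_n with class sizes n_1, ..., n_k is
   V_{n,k} times a product of the (1 - alpha)_(n_j - 1); the factor V_{n,k}
   depends only on (n, k) and cancels after conditioning.  Both the law of the
   records and the joint law of records and frequencies are computed by
   induction on n along the Markov chain.  For the records it is V_{n,k} times
   one factor m - alpha k_m for each m < n such that m + 1 is not a record, where
   k_m is the number of classes of Pi_m, and these factors telescope into
   1 / psi.  For the joint law, n + 1 either opens a class or joins the
   j-th one, and the sum over j of the weights of the frequencies with n_j
   decreased by one is reduced by Pascal's rule to the product of binomial
   coefficients. *)

(** * Euler's integral: functional equation, finiteness and positivity at positive arguments *)

Section gamma.
Variable R : realType.
Implicit Types x y t a b : R.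
Notation mu := (@lebesgue_measure R).

Definition gamma_integrand x t : R := t `^ (x - 1) * expR (- t).

(** Kept in the extended reals because [fine] sends an infinite integral to 0, and the functional
    equation is proved before finiteness. *)
Definition egamma x : \bar R :=
  (\int[mu]_(t in `]0%R, +oo[) (gamma_integrand x t)%:E)%E.

Lemma GammaE x : Gamma x = fine (egamma x).
Proof. by []. Qed.

Lemma gamma_integrand_ge0 x t : 0 <= gamma_integrand x t.
Proof. by rewrite mulr_ge0 ?powR_ge0 ?expR_ge0. Qed.

Lemma measurable_gamma_integrand x (D : set R) :
  measurable_fun D (gamma_integrand x).
Proof.
apply: measurable_funTS; apply: measurable_funM.
  exact: measurable_powR.
by apply: measurableT_comp => //; exact: measurable_funN.
Qed.

Lemma egamma_ge0 x : (0 <= egamma x)%E.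
Proof. by apply: integral_ge0 => t _; rewrite lee_fin gamma_integrand_ge0. Qed.

(* From [u <= expR u] at [u = t / (2 x)]. *)
Lemma powR_expRN_le x t : 0 < x -> 0 <= t ->
  t `^ x * expR (- t) <= (x *+ 2) `^ x * expR (- t / 2).
Proof.
move=> x0 t0.
have h : t <= x *+ 2 * expR (t / (x *+ 2)).
  have x20 : 0 < x *+ 2 by rewrite mulrn_wgt0.
  have : t / (x *+ 2) <= expR (t / (x *+ 2)).
    by rewrite (le_trans _ (expR_ge1Dx _))// lerDr.
  by rewrite ler_pdivrMr// mulrC.
have : t `^ x <= (x *+ 2) `^ x * expR (t / 2).
  have := ge0_ler_powR (ltW x0) _ _ h.
  rewrite !nnegrE t0 mulr_ge0 ?expR_ge0 ?mulrn_wge0 ?(ltW x0)// => /(_ isT isT).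
  rewrite powRM ?expR_ge0 ?mulrn_wge0 ?(ltW x0)//.
  rewrite -[expR _ `^ x]expRM.
  suff -> : t / (x *+ 2) * x = t / 2 by [].
  by rewrite -mulr_natr; field; rewrite gt_eqF.
move=> /(ler_wpM2r (expR_ge0 (- t))) /le_trans; apply.
rewrite -mulrA ler_wpM2l ?powR_ge0// -expRD.
suff -> : t / 2 + - t = - t / 2 by [].
by field.
Qed.

Lemma derivable_powR_gt0 x t : 0 < t -> derivable (fun u : R => u `^ x) t 1.
Proof. by move=> t0; have [] := @is_derive1_powR R x t t0. Qed.

Lemma derivable_continuous_at (f : R -> R) t : derivable f t 1 ->
  {for t, continuous f}.
Proof. by move=> /derivable1_diffP/differentiable_continuous. Qed.

Lemma derivable_itvcc (f : R -> R) a b : 0 < a -> a < b ->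
  (forall t, 0 < t -> derivable f t 1) ->
  derivable_oo_LRcontinuous f a b /\ {within `[a, b], continuous f}.
Proof.
move=> a0 ab df; split; [split|].
- move=> t; rewrite in_itv/= => /andP[at_ _]; exact/df/(lt_trans a0).
- by apply: cvg_at_right_filter; apply: derivable_continuous_at; exact: df.
- apply: cvg_at_left_filter; apply: derivable_continuous_at; apply: df.
  exact: lt_trans ab.
- apply: derivable_within_continuous => t; rewrite in_itv/= => /andP[at_ _].
  exact/df/(lt_le_trans a0).
Qed.

(** Away from 0 the integrands are smooth, so the primitive [- expR (- t)] can be used on a compact
    interval; the boundary terms are kept for the later limit. *)
Lemma gamma_by_parts x a b : 0 < a -> a < b ->
  (\int[mu]_(t in `[a, b]) (gamma_integrand (x + 1) t)%:E =
   (a `^ x * expR (- a) - b `^ x * expR (- b))%:E +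
   x%:E * \int[mu]_(t in `[a, b]) (gamma_integrand x t)%:E)%E.
Proof.
move=> a0 ab.
pose F t : R := t `^ x; pose f t : R := x * t `^ (x - 1).
pose G t : R := - expR (- t); pose g t : R := expR (- t).
have dP t : 0 < t -> derivable F t 1 by exact: derivable_powR_gt0.
have de t : is_derive t 1 G (g t).
  rewrite /G; apply: is_derive_eq.
  by rewrite /g /GRing.scale/= mulrN1 opprK.
have [dF cF] := derivable_itvcc a0 ab dP.
have [dG cG] : derivable_oo_LRcontinuous G a b /\ {within `[a, b], continuous G}.
  by apply: derivable_itvcc => // t _; have [] := de t.
have [_ cg] : derivable_oo_LRcontinuous g a b /\ {within `[a, b], continuous g}.
  by apply: derivable_itvcc => // t _; apply: ex_derive.
have [_ cf] : derivable_oo_LRcontinuous f a b /\ {within `[a, b], continuous f}.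
  apply: derivable_itvcc => // t t0; apply: derivableM => //.
  exact: derivable_powR_gt0.
have Ff : {in `]a, b[, F^`()%classic =1 f}.
  move=> t; rewrite in_itv/= => /andP[at_ _]; rewrite powR_derive1//.
  by rewrite in_itv/= andbT (lt_trans a0).
have Gg : {in `]a, b[, G^`()%classic =1 g}.
  by move=> t _; rewrite derive1E; have [_ ->] := de t.
have iI : mu.-integrable `[a, b] (fun t => (gamma_integrand x t)%:E).
  apply: continuous_compact_integrable; first exact: segment_compact.
  have [] // := @derivable_itvcc (gamma_integrand x) a b a0 ab.
  move=> t t0; apply: derivableM; first exact: derivable_powR_gt0.
  exact: ex_derive.
have -> : (\int[mu]_(t in `[a, b]) (gamma_integrand (x + 1) t)%:E =
           \int[mu]_(t in `[a, b]) (F t * g t)%:E)%E.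
  by apply: eq_integral => t _; rewrite /gamma_integrand addrK.
rewrite (integration_by_parts ab cf dF Ff cg dG Gg).
have -> : (\int[mu]_(t in `[a, b]) (f t * G t)%:E =
           \int[mu]_(t in `[a, b]) ((- x)%:E * (gamma_integrand x t)%:E))%E.
  apply: eq_integral => t _; rewrite -EFinM; congr EFin.
  by rewrite /f /G /gamma_integrand mulrN mulNr mulrA.
rewrite integralZl// EFinN mulNe oppeK; congr (_%:E + _)%E.
by rewrite /F /G; ring.
Qed.

Lemma cvg_powR_expRN x : 0 < x ->
  n.+2%:R `^ x * expR (- n.+2%:R) @[n --> \oo] --> (0 : R).
Proof.
move=> x0; apply: (@squeeze_cvgr _ _ _ _ (cst 0)
    (fun n => (x *+ 2) `^ x * expR (- n.+2%:R / 2))).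
- by near=> n; rewrite mulr_ge0 ?powR_ge0 ?expR_ge0//= powR_expRN_le.
- exact: cvg_cst.
- rewrite -[X in _ --> X](mulr0 ((x *+ 2) `^ x)); apply: cvgMr.
  (* After the exponential bound the sequence is geometric, of ratio [expR (- 2^-1)] below 1. *)
  have -> : (fun n => expR (- n.+2%:R / 2)) =
      (fun n => expR (- 2^-1) ^+ n * expR (- 1)) :> (nat -> R).
    apply/funext => n; rewrite -expRM_natr -expRD; congr expR.
    by rewrite -addn2 natrD; field.
  rewrite -[X in _ --> X](mul0r (expR (- 1 : R))); apply: cvgMl.
  by apply: cvg_expr; rewrite ger0_norm ?expR_ge0// -expR0 ltr_expR oppr_lt0.
Unshelve. all: by end_near. Qed.

Lemma cvg_powR_inv x : 0 < x ->
  n.+2%:R^-1 `^ x * expR (- n.+2%:R^-1) @[n --> \oo] --> (0 : R).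
Proof.
move=> x0; apply: (@squeeze_cvgr _ _ _ _ (cst 0) (fun n => n.+2%:R^-1 `^ x)).
- near=> n; rewrite mulr_ge0 ?powR_ge0 ?expR_ge0//=.
  by rewrite ler_piMr ?powR_ge0// -expR0 ler_expR oppr_le0.
- exact: cvg_cst.
- have /cvg_at_rightP := powR_cvg0 x0; apply; split; first by [].
  by have := @cvg_harmonic R; rewrite -cvg_shiftS.
Unshelve. all: by end_near. Qed.

Lemma itvoy_bigcup : `]0%R, +oo[%classic =
  \bigcup_n `[n.+2%:R^-1, n.+2%:R]%classic :> set R.
Proof.
apply/seteqP; split => t /=; rewrite in_itv/= andbT.
  (* Truncating the larger of [t] and [t^-1] gives an index whose interval contains [t]. *)
  move=> t0; exists (Num.truncn (Num.max t t^-1)) => //=; rewrite in_itv/=.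
  have /ltW := truncnS_gt (Num.max t t^-1).
  rewrite ge_max => /andP[h1 h2].
  set m := Num.truncn _ in h1 h2 *.
  have h3 : m.+1%:R <= m.+2%:R :> R by rewrite ler_nat.
  apply/andP; split; last exact: le_trans h3.
  by rewrite -[leRHS]invrK lef_pV2 ?posrE ?invr_gt0// (le_trans h2).
move=> [n _] /=; rewrite in_itv/= => /andP[+ _]; apply: lt_le_trans.
by rewrite invr_gt0.
Qed.

(** Monotone convergence along an exhausting family; the shift by two makes every interval
    nondegenerate, as integration by parts requires. *)
Lemma cvg_egamma x :
  (\int[mu]_(t in `[(n.+2%:R^-1)%R, n.+2%:R%R]) (gamma_integrand x t)%:E
     @[n --> \oo] --> egamma x)%E.
Proof.
rewrite /egamma itvoy_bigcup; apply: ge0_nondecreasing_set_cvg_integral.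
- move=> m n mn; rewrite subsetEset => t; rewrite /= !in_itv/= => /andP[h1 h2].
  apply/andP; split.
    by rewrite (le_trans _ h1)// lef_pV2 ?posrE// ler_nat !ltnS.
  by rewrite (le_trans h2)// ler_nat !ltnS.
- by [].
- by move=> n; apply/measurable_EFinP; exact: measurable_gamma_integrand.
- by move=> n t _; rewrite lee_fin gamma_integrand_ge0.
Qed.

(** Limit of the integration by parts: both boundary terms vanish because [0 < x]. *)
Lemma egammaD1 x : 0 < x -> egamma (x + 1) = (x%:E * egamma x)%E.
Proof.
move=> x0;
rewrite -(cvg_lim (@ereal_hausdorff R) (@cvg_egamma (x + 1))).
have -> : (fun n : nat => \int[mu]_(t in `[(n.+2%:R^-1)%R, n.+2%:R%R])
      (gamma_integrand (x + 1) t)%:E)%E =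
    (fun n : nat => (n.+2%:R^-1 `^ x * expR (- n.+2%:R^-1)
                     - n.+2%:R `^ x * expR (- n.+2%:R))%:E +
      x%:E * \int[mu]_(t in `[(n.+2%:R^-1)%R, n.+2%:R%R])
        (gamma_integrand x t)%:E)%E.
  apply/funext => n; rewrite gamma_by_parts//.
  by rewrite (@lt_trans _ _ 1)// ?ltr1n// invf_lt1// ltr1n.
have c0 : ((n.+2%:R^-1 `^ x * expR (- n.+2%:R^-1)
    - n.+2%:R `^ x * expR (- n.+2%:R))%:E @[n --> \oo] --> (0 : \bar R))%E.
  apply: cvg_EFin; first by near=> n.
  rewrite -[X in _ --> X](subrr 0); apply: cvgB.
    exact: cvg_powR_inv.
  exact: cvg_powR_expRN.
apply: cvg_lim => //.
have := cvgeD _ c0 (cvgeZl (_ : x%:E \is a fin_num) (@cvg_egamma x)).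
by rewrite add0e; apply.
Unshelve. all: by end_near. Qed.

(** On []0, +oo[] the integrand is the exponential density of rate 1, whose total mass is 1. *)
Lemma egamma1 : (egamma (1 : R) < +oo)%E.
Proof.
apply: (@le_lt_trans _ _ 1%E); last exact: ltry.
rewrite -(@integral_exponential_pdf R 1)//.
have -> : egamma 1 = (\int[mu]_(t in `]0%R, +oo[) (exponential_pdf 1 t)%:E)%E.
  apply: eq_integral => t; rewrite inE/= in_itv/= andbT => t0.
  rewrite exponential_pdfE ?(ltW t0)// /gamma_integrand.
  by rewrite subrr powRr0 !mul1r mulN1r.
apply: ge0_subset_integral => //.
  by apply/measurable_EFinP; exact: measurable_exponential_pdf.
by move=> t _; rewrite lee_fin exponential_pdf_ge0.
Qed.

Lemma egamma_nat n : (egamma (n.+1%:R : R) < +oo)%E.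
Proof.
elim: n => [|n ih]; first exact: egamma1.
by rewrite -addn1 natrD egammaD1// lte_mul_pinfty.
Qed.

(* For 1 <= y <= N + 1 the integrand is at most the sum of those of Gamma 1 and
   Gamma (N + 1); the values in ]0, 1[ follow from the functional equation. *)
Lemma egamma_lty x : 0 < x -> (egamma x < +oo)%E.
Proof.
suff egamma_ge1 y : 1 <= y -> (egamma y < +oo)%E.
  move=> x0; have := egamma_ge1 (x + 1).
  rewrite lerDr (ltW x0) egammaD1// => /(_ isT).
  have := egamma_ge0 x; case: (egamma x) => [r _ _|_|//].
    by rewrite ltry.
  by rewrite mulry gtr0_sg// mul1e.
move=> y1; pose N := Num.truncn y.
have yN : y <= N.+1%:R by rewrite ltW// truncnS_gt.
apply: (@le_lt_trans _ _ (egamma (1%R : R) + egamma N.+1%:R)%E); last first.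
  by rewrite lte_add_pinfty ?egamma1 ?egamma_nat.
rewrite /egamma -ge0_integralD//; last 4 first.
- by move=> t _; rewrite lee_fin gamma_integrand_ge0.
- by apply/measurable_EFinP; exact: measurable_gamma_integrand.
- by move=> t _; rewrite lee_fin gamma_integrand_ge0.
- by apply/measurable_EFinP; exact: measurable_gamma_integrand.
apply: ge0_le_integral => //.
- by move=> t _; rewrite lee_fin gamma_integrand_ge0.
- by apply/measurable_EFinP; exact: measurable_gamma_integrand.
- by apply/measurable_EFinP; apply: measurable_funD;
    exact: measurable_gamma_integrand.
move=> t; rewrite /= in_itv/= andbT => t0.
rewrite -EFinD lee_fin /gamma_integrand -mulrDl ler_wpM2r ?expR_ge0//.
rewrite subrr powRr0; have [t1|t1] := leP t 1.
  rewrite (@le_trans _ _ (t `^ 0))// ?powRr0 ?lerDl ?powR_ge0//.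
  by rewrite -[leRHS](powRr0 t) ger_powR ?t0// subr_ge0.
by rewrite (@le_trans _ _ (t `^ (N.+1%:R - 1)))// ?lerDr// ler_powR ?(ltW t1)// lerD2r.
Qed.

Lemma egamma_fin x : 0 < x -> egamma x \is a fin_num.
Proof. by move=> x0; rewrite ge0_fin_numE ?egamma_ge0 ?egamma_lty. Qed.

Lemma GammaD1 x : 0 < x -> Gamma (x + 1) = x * Gamma x.
Proof.
by move=> x0; rewrite !GammaE egammaD1// fineM// egamma_fin.
Qed.

(** A zero integral would make the integrand vanish almost everywhere, but it is positive on a
    half-line of infinite measure. *)
Lemma Gamma_gt0 x : 0 < x -> 0 < Gamma x.
Proof.
move=> x0; rewrite GammaE fine_gt0// egamma_lty// andbT lt_neqAle egamma_ge0.
rewrite andbT; apply/negP => /eqP h.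
have mD : measurable (`]0%R, +oo[ : set R) by [].
have mf : measurable_fun (`]0%R, +oo[ : set R) (EFin \o gamma_integrand x).
  by apply/measurable_EFinP; exact: measurable_gamma_integrand.
have [|A [mA A0 sub]] := (ae_eq_integral_abs mu mD mf).1.
  rewrite h; apply: eq_integral => t _.
  by rewrite /= ger0_norm ?gamma_integrand_ge0.
have : (mu `]0%R, +oo[ <= mu A)%E.
  apply: le_measure; rewrite ?inE// => t t0; apply: sub => /= /(_ t0) [] /eqP.
  have {}t0 : 0 < t by move: t0; rewrite /= in_itv/= andbT.
  by rewrite /gamma_integrand gt_eqF// mulr_gt0 ?powR_gt0 ?expR_gt0.
by rewrite A0 lebesgue_measure_itv/= ltry.
Qed.

End gamma.

(** * The product of class weights and its Pascal recursion *)

Section frequency_weight.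
Variables (R : realType) (alpha : R).
Implicit Types (i nn : seq nat).

(** Polynomial form of [rising] at integer arguments, whose recursion is pure algebra. *)
Definition rise (a : R) (r : nat) : R := \prod_(l < r) (a + l%:R).

Lemma riseS a r : rise a r.+1 = rise a r * (a + r%:R).
Proof. by rewrite /rise big_ord_recr. Qed.

Lemma risingE (a : R) r : 0 < a -> rising a r%:R = rise a r.
Proof.
move=> a0; elim: r => [|r ih].
  by rewrite /rising addr0 divff ?gt_eqF ?Gamma_gt0// /rise big_ord0.
rewrite riseS -ih /rising -natr1 addrA GammaD1; last by rewrite ltr_wpDr.
by rewrite -mulrA mulrC.
Qed.

(* The contribution to the joint law of a class of size [m] with record index
   [x], where [S] is the total size of the older classes; it vanishes when the
   compatibility condition fails at this class. *)
Definition class_weight (x S m : nat) : R :=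
  if ((0 < m) && (x <= S.+1))%N
  then 'C(S + m - x, m.-1)%:R * rise (1 - alpha) m.-1 else 0.

Definition freq_weight i nn : R :=
  \prod_(j < size i)
    class_weight (nth 0%N i j) (sumn (take j nn)) (nth 0%N nn j).

Lemma freq_weight_rcons i nn x m : size i = size nn ->
  freq_weight (rcons i x) (rcons nn m) =
  freq_weight i nn * class_weight x (sumn nn) m.
Proof.
move=> e; rewrite /freq_weight size_rcons big_ord_recr/=; congr (_ * _).
  apply: eq_bigr => j _; rewrite !nth_rcons -e ltn_ord -cats1 takel_cat//.
  by rewrite -e ltnW.
by rewrite !nth_rcons e ltnn eqxx -cats1 takel_cat// take_size.
Qed.

Lemma freq_weight_nth0 i nn j : (j < size i)%N -> nth 0%N nn j = 0%N ->
  freq_weight i nn = 0.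
Proof.
move=> ji nj; rewrite /freq_weight (bigD1 (Ordinal ji))//= nj.
by rewrite /class_weight ltnn/= mul0r.
Qed.

(** The newest element sits in an older class or in this one. Both binomials on the left have the
    same upper index, and [m - 1 - alpha] is the factor that [rise] gains from length [m - 2] to
    [m - 1], so Pascal's rule applies. *)
Lemma class_weight_pascal x S m : (0 < x <= S)%N ->
  class_weight x S.-1 m + (m%:R - 1 - alpha) * class_weight x S m.-1 =
  class_weight x S m.
Proof.
case: S => [|S]; first by case: x.
move=> /andP[x0 xS]; rewrite /class_weight /= xS (leq_trans xS)//.
case: m => [|[|m]] /=; first by rewrite mulr0 addr0.
  by rewrite mulr0 addr0 !bin0.
rewrite riseS -[in RHS](_ : (S + m.+2 - x).+1 = S.+1 + m.+2 - x)%N; last by lia.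
rewrite binS natrD -(_ : S + m.+2 - x = S.+1 + m.+1 - x)%N; last by lia.
by rewrite -!natr1; ring.
Qed.

(** If [x = S + 1], the older classes were complete when this one opened, so only its own growth
    counts and the binomials equal 1; for larger [x] both sides vanish. *)
Lemma class_weight_first x S m : (0 < x)%N -> (S < x < S + m)%N ->
  (m%:R - 1 - alpha) * class_weight x S m.-1 = class_weight x S m.
Proof.
move=> x0 /andP[Sx xSm]; rewrite /class_weight.
have [xS|] := leqP x S.+1; last by rewrite !andbF mulr0.
have -> : x = S.+1 by apply/eqP; rewrite eqn_leq xS.
case: m xSm => [|[|m]] xSm /=; [lia|lia|].
have -> : (S + m.+1 - S.+1 = m)%N by lia.
have -> : (S + m.+2 - S.+1 = m.+1)%N by lia.
by rewrite !binn riseS -!natr1; ring.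
Qed.

(** The frequencies before an element joined class [j]; an entry 0 stays 0, hence the case
    distinctions on positivity below. *)
Definition decr j nn : seq nat := set_nth 0%N nn j (nth 0%N nn j).-1.

Lemma decr_rcons j nn m : (j < size nn)%N ->
  decr j (rcons nn m) = rcons (decr j nn) m.
Proof.
by elim: nn j => [//|y nn ih] [//|j] /= jn; congr (_ :: _); exact: ih.
Qed.

Lemma decr_rcons_size nn m : decr (size nn) (rcons nn m) = rcons nn m.-1.
Proof. by rewrite /decr nth_rcons ltnn eqxx; elim: nn => //= y nn ->. Qed.

Lemma size_decr j nn : (j < size nn)%N -> size (decr j nn) = size nn.
Proof. by move=> jn; rewrite size_set_nth; apply/maxn_idPr. Qed.

Lemma sumn_decr j nn : (j < size nn)%N -> (0 < nth 0%N nn j)%N ->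
  sumn (decr j nn) = (sumn nn).-1.
Proof.
move=> jn nj; rewrite /decr sumn_set_nth_ltn//; lia.
Qed.

(** Recursion over the possible parents of [nn] when the newest element is not a record. Induction
    on the last class: decrementing an older class changes the last weight only by lowering [S],
    which gives one Pascal term; decrementing the last class gives the other. *)
Lemma freq_weight_decr i nn : size i = size nn -> path ltn 0%N i ->
  (last 0%N i < sumn nn)%N ->
  \sum_(j < size nn) ((nth 0%N nn j)%:R - 1 - alpha) * freq_weight i (decr j nn) =
  freq_weight i nn.
Proof.
elim/last_ind: i nn => [|i x ih] nn; first by case: nn.
case/lastP: nn => [|nn m]; first by rewrite size_rcons.
rewrite !size_rcons => -[e]; rewrite rcons_path last_rcons sumn_rcons.
move=> /andP[iP ix] xS; rewrite big_ord_recr/= decr_rcons_size.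
rewrite nth_rcons ltnn eqxx !freq_weight_rcons//.
have -> : \sum_(j < size nn) ((nth 0%N (rcons nn m) j)%:R - 1 - alpha) *
      freq_weight (rcons i x) (decr j (rcons nn m)) =
    (\sum_(j < size nn) ((nth 0%N nn j)%:R - 1 - alpha) *
      freq_weight i (decr j nn)) * class_weight x (sumn nn).-1 m.
  rewrite mulr_suml; apply: eq_bigr => j _.
  rewrite nth_rcons ltn_ord decr_rcons// freq_weight_rcons ?size_decr//.
  (* With [n_j = 0] the truncated decrement leaves the total unchanged, but the weight of the older
     classes is then 0. *)
  have [nj0|nj0] := posnP (nth 0%N nn j).
    rewrite (@freq_weight_nth0 _ _ j) ?e//; first by rewrite !(mulr0,mul0r).
    by rewrite nth_set_nth/= eqxx nj0.
  by rewrite sumn_decr// mulrA.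
have x0 : (0 < x)%N by exact: leq_ltn_trans ix.
have [xle|xgt] := leqP x (sumn nn).
  by rewrite ih ?(leq_trans ix)// -[in RHS]class_weight_pascal ?x0//; ring.
rewrite mulrCA class_weight_first ?xgt//.
have [e0|n0] := posnP (size nn); first by rewrite e0 big_ord0 mul0r add0r.
(* If the older total is 0, the bound [S.-1.+1] is 1 instead of [S]; an older record exists, so [x]
   is at least 2 and the test still fails. *)
have -> : class_weight x (sumn nn).-1 m = 0.
  rewrite /class_weight ifF//; apply/negbTE; rewrite negb_and.
  apply/orP; right; rewrite -ltnNge.
  case: (sumn nn) xgt => [_|//]; apply: leq_trans ix.
  case/lastP: i iP e {ih} => [_ e|i y]; first by rewrite -e in n0.
  by rewrite rcons_path last_rcons => /andP[_ ly] _; rewrite ltnS (leq_ltn_trans _ ly).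
by rewrite mulr0 add0r.
Qed.

End frequency_weight.

(** * Decomposing probabilities over finitely many states *)

Section finite_decomposition.
Variables (R : realType) (d : measure_display) (T : measurableType d).
Variable P : probability T R.

Lemma fine_prob_ge0 (A : set T) : 0 <= fine (P A).
Proof. exact: fine_ge0. Qed.

(** The event is a countable union over the codes of states, each piece being empty or a
    single-state event. *)
Lemma measurable_preimage_countable (S : countType) (X : T -> S) (A : set S) :
  (forall s, measurable [set w | X w = s]) -> measurable [set w | A (X w)].
Proof.
move=> mX; have -> : [set w | A (X w)] =
    \bigcup_k [set w | A (X w) /\ choice.pickle (X w) = k].
  by apply/seteqP; split => [w ?|w [k _ []//]]; exists (choice.pickle (X w)).
apply: bigcupT_measurable => k.
have [[s [sA sk]]|ns] := pselect (exists s, A s /\ choice.pickle s = k).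
  rewrite (_ : [set w | _] = [set w | X w = s])//.
  apply/seteqP; split => w /=; last by move=> ->.
  by rewrite -sk => -[_] /(pcan_inj choice.pickleK).
rewrite (_ : [set w | _] = set0)//; apply/seteqP; split => w //= h.
by apply: ns; exists (X w).
Qed.

Variables (S : countType) (X : T -> S).
Hypothesis mX : forall s, measurable [set w | X w = s].

Lemma fine_prob_mem (L : seq S) (G : set T) : uniq L -> measurable G ->
  fine (P ([set w | X w \in L] `&` G)) =
  \sum_(c <- L) fine (P ([set w | X w = c] `&` G)).
Proof.
move=> + mG; elim: L => [_|c L ih /= /andP[cL uL]].
  rewrite big_nil (_ : _ `&` _ = set0) ?measure0//.
  by apply/seteqP; split => w // -[].
rewrite big_cons -ih// -fineD ?fin_num_measure//; last 2 first.
- by apply: measurableI.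
- by apply: measurableI => //; exact: (measurable_preimage_countable [set s | s \in L]).
- rewrite -measureU//; last 3 first.
  + by apply: measurableI.
  + by apply: measurableI => //; exact: (measurable_preimage_countable [set s | s \in L]).
  + apply/seteqP; split => w //= -[[-> _] [cL' _]].
    by rewrite cL' in cL.
  congr (fine (P _)); rewrite -setIUl; congr (_ `&` _).
  apply/seteqP; split => w /=; rewrite inE.
    by case/predU1P; [left|right].
  by move=> [->|->]; rewrite ?eqxx ?orbT.
Qed.

(** When the listed states carry all the mass of [E], the rest of [E] is null, and so is the rest of
    any [F] inside [E]; no infinite sum arises. *)
Lemma fine_prob_decomposition (L : seq S) (E F : set T) : uniq L ->
  measurable E -> measurable F -> F `<=` E ->
  \sum_(c <- L) fine (P ([set w | X w = c] `&` E)) = fine (P E) ->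
  fine (P F) = \sum_(c <- L) fine (P ([set w | X w = c] `&` F)).
Proof.
move=> uL mE mF FE; rewrite -!fine_prob_mem//.
set U := [set w | X w \in L].
have mU : measurable U by exact: (measurable_preimage_countable [set s | s \in L]).
have decomp G : measurable G -> fine (P G) = fine (P (U `&` G)) + fine (P (G `\` U)).
  move=> mG; rewrite -fineD ?fin_num_measure//; last 2 first.
  - exact: measurableI.
  - exact: measurableD.
  by rewrite setIC addeC -measureDI.
rewrite (decomp E)// (decomp F)// => /esym/eqP.
rewrite -subr_eq0 addrAC subrr add0r => /eqP E0.
suff -> : fine (P (F `\` U)) = 0 by rewrite addr0.
apply/eqP; rewrite eq_le fine_prob_ge0 andbT -E0 fine_le ?fin_num_measure//.
- exact: measurableD.
- exact: measurableD.
- apply: le_measure; rewrite ?inE; [exact: measurableD|exact: measurableD|].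
  exact: setSD.
Qed.

End finite_decomposition.

(** * Reachable partitions and the two moves of the chain *)

Section ordered_partitions.
Implicit Types (B : {fset nat}) (s : seq {fset nat}).

Lemma leastP B : B != fset0 -> least B \in B /\ forall y, y \in B -> (least B <= y)%N.
Proof.
move=> B0; rewrite /least.
have e y : (y \in sort leq B) = (y \in B) by rewrite mem_sort.
have := sort_sorted leq_total B.
case: (sort leq B) e => [|x l] e /= so.
  by case/fset0Pn: B0 => y; rewrite -e.
split; first by rewrite -e mem_head.
move=> y; rewrite -e inE => /predU1P[->//|yl].
exact: (allP (order_path_min leq_trans so)).
Qed.

Lemma least_eq B x : x \in B -> (forall y, y \in B -> (x <= y)%N) -> least B = x.
Proof.
move=> xB xmin; have [|lB lmin] := @leastP B; first by apply/fset0Pn; exists x.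
by apply/eqP; rewrite eqn_leq lmin// xmin.
Qed.

Lemma least_fset1 x : least [fset x]%fset = x.
Proof. by apply: least_eq => [|y]; rewrite inE// => /eqP ->. Qed.

Lemma least_fsetU1 B x : B != fset0 -> (forall y, y \in B -> (y <= x)%N) ->
  least (x |` B)%fset = least B.
Proof.
move=> /leastP[lB lmin] Bx; apply: least_eq; first by rewrite !inE lB orbT.
by move=> y; rewrite !inE => /predU1P[->|/lmin//]; exact: Bx.
Qed.

Definition children (n : nat) s : seq (seq {fset nat}) :=
  new_class s n.+1 :: [seq join_class s j n.+1 | j <- iota 0 (size s)].

(* Index shift: [partitions m] lists the states reachable at time [m.+1]. *)
Fixpoint partitions (m : nat) : seq (seq {fset nat}) :=
  if m is m'.+1 then undup (flatten [seq children m s | s <- partitions m'])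
  else [:: [:: [fset 1%N]%fset]].

(** Invariants preserved by both moves. [tracked_le] makes [n.+1] a fresh element, so a join raises
    one frequency and leaves all least elements unchanged. *)
Record tracked_partition (n : nat) s : Prop := {
  tracked_nonempty : forall B, B \in s -> B != fset0;
  tracked_le : forall B y, B \in s -> y \in B -> (y <= n)%N;
  tracked_size : (0 < size s <= n)%N;
  tracked_sum : sumn (frequencies s) = n;
  tracked_path : path ltn 0%N (record_indices s);
  tracked_last : (last 0%N (record_indices s) <= n)%N }.

Lemma size_record_indices s : size (record_indices s) = size s.
Proof. exact: size_map. Qed.

Lemma size_frequencies s : size (frequencies s) = size s.
Proof. exact: size_map. Qed.

Lemma record_indices_new_class s x :
  record_indices (new_class s x) = rcons (record_indices s) x.
Proof. by rewrite /record_indices map_rcons least_fset1. Qed.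

Lemma frequencies_new_class s x :
  frequencies (new_class s x) = rcons (frequencies s) 1%N.
Proof. by rewrite /frequencies map_rcons cardfs1. Qed.

Lemma size_join_class s j x : (j < size s)%N -> size (join_class s j x) = size s.
Proof. by move=> js; rewrite size_set_nth; apply/maxn_idPr. Qed.

Lemma record_indices_join_class n s j : tracked_partition n s -> (j < size s)%N ->
  record_indices (join_class s j n.+1) = record_indices s.
Proof.
move=> ts js; apply: (@eq_from_nth _ 0%N).
  by rewrite !size_record_indices size_join_class.
move=> l; rewrite size_record_indices size_join_class// => ls.
rewrite !(nth_map fset0) ?size_join_class// nth_set_nth/=.
case: eqP => [->|//]; rewrite least_fsetU1//.
  exact/(tracked_nonempty ts)/mem_nth.
by move=> y /(tracked_le ts (mem_nth _ js)) /leqW.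
Qed.

Lemma frequencies_join_class n s j : tracked_partition n s -> (j < size s)%N ->
  frequencies (join_class s j n.+1) = incr_nth (frequencies s) j.
Proof.
move=> ts js; apply: (@eq_from_nth _ 0%N).
  by rewrite size_incr_nth !size_frequencies js size_join_class.
move=> l; rewrite size_frequencies size_join_class// => ls.
rewrite nth_incr_nth !(nth_map fset0) ?size_join_class// nth_set_nth/=.
rewrite [j == l]eq_sym; case: eqP => [->|//]; rewrite cardfsU1.
case: (boolP (n.+1 \in _)) => [/(tracked_le ts (mem_nth _ js))|//].
by rewrite ltnn.
Qed.

Lemma childrenP n s c : reflect
  (c = new_class s n.+1 \/ exists2 j, (j < size s)%N & c = join_class s j n.+1)
  (c \in children n s).
Proof.
rewrite inE; apply: (iffP idP).
  case/predU1P => [->|/mapP[j]]; first by left.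
  by rewrite mem_iota/= => js ->; right; exists j.
case=> [->|[j js ->]]; first by rewrite eqxx.
by apply/orP; right; apply/mapP; exists j; rewrite ?mem_iota.
Qed.

Lemma sumn_incr_nth (l : seq nat) j : (j < size l)%N ->
  sumn (incr_nth l j) = (sumn l).+1.
Proof.
by elim: l j => [//|y l ih] [|j] //= jl; rewrite ih// addnS.
Qed.

Lemma tracked_children n s c : tracked_partition n s -> c \in children n s ->
  tracked_partition n.+1 c.
Proof.
move=> ts /childrenP[->|[j js ->]]; split.
- move=> B; rewrite mem_rcons inE => /predU1P[->|/(tracked_nonempty ts)//].
  by apply/fset0Pn; exists n.+1; rewrite inE.
- move=> B y; rewrite mem_rcons inE => /predU1P[->|Bs yB].
    by rewrite inE => /eqP ->.
  exact/leqW/(tracked_le ts Bs).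
- by rewrite size_rcons ltnS; have /andP[] := tracked_size ts.
- by rewrite frequencies_new_class sumn_rcons (tracked_sum ts) addn1.
- rewrite record_indices_new_class rcons_path (tracked_path ts)/=.
  exact: tracked_last.
- by rewrite record_indices_new_class last_rcons.
- move=> B /(nthP fset0)[l]; rewrite size_join_class// => ls <-.
  rewrite nth_set_nth/=; case: (l =P j) => _.
    by apply/fset0Pn; exists n.+1; rewrite !inE eqxx.
  exact/(tracked_nonempty ts)/mem_nth.
- move=> B y /(nthP fset0)[l]; rewrite size_join_class// => ls <-.
  rewrite nth_set_nth/=; case: (l =P j) => _.
    by rewrite !inE => /predU1P[->//|/(tracked_le ts (mem_nth _ js))/leqW].
  by move=> /(tracked_le ts (mem_nth _ ls))/leqW.
- rewrite size_join_class//; have /andP[-> ] := tracked_size ts.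
  exact: leqW.
- by rewrite (frequencies_join_class ts)// sumn_incr_nth ?size_frequencies//
    (tracked_sum ts).
- by rewrite (record_indices_join_class ts)// (tracked_path ts).
- by rewrite (record_indices_join_class ts)// leqW// (tracked_last ts).
Qed.

(** Opening a class changes the number of classes, and two joins differ in the frequency that
    grows. *)
Lemma uniq_children n s : tracked_partition n s -> uniq (children n s).
Proof.
move=> ts; rewrite /= map_inj_in_uniq ?iota_uniq ?andbT.
  apply/mapP => -[j]; rewrite mem_iota/= => js /(congr1 size).
  by rewrite size_rcons size_join_class// => /eqP; rewrite -[_ == _]/(_.+1 == _) gtn_eqF.
move=> j l; rewrite !mem_iota/= => js ls /(congr1 frequencies).
rewrite !(frequencies_join_class ts)// => /(congr1 (fun f => nth 0%N f j)).
rewrite !nth_incr_nth eqxx; case: eqP => // _ /eqP.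
by rewrite add0n add1n -[_ == _]/(_.+1 == _) gtn_eqF.
Qed.

Lemma tracked_partition1 : tracked_partition 1 [:: [fset 1%N]%fset].
Proof.
split => //=; rewrite ?cardfs1 ?least_fset1//.
- by move=> B; rewrite inE => /eqP ->; apply/fset0Pn; exists 1%N; rewrite inE.
- by move=> B y; rewrite inE => /eqP ->; rewrite inE => /eqP ->.
Qed.

Lemma partitions_tracked m s : s \in partitions m -> tracked_partition m.+1 s.
Proof.
elim: m s => [s|m ih s] /=.
  by rewrite inE => /eqP ->; exact: tracked_partition1.
rewrite mem_undup => /flatten_mapP[s' /ih ts' sc].
exact: tracked_children ts' sc.
Qed.

Lemma uniq_partitions m : uniq (partitions m).
Proof. by case: m => //= m; rewrite undup_uniq. Qed.

Lemma ordered_partition1 s : ordered_partition 1 s -> s = [:: [fset 1%N]%fset].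
Proof.
move=> [ne dis cov _].
have e B : B \in s -> B = [fset 1%N]%fset.
  move=> Bs; have B1 y : y \in B -> y = 1%N.
    move=> yB; have : has (fun C : {fset nat} => y \in C) s by apply/hasP; exists B.
    by rewrite cov; case: y {yB} => [|[]].
  apply/fsetP => y; rewrite inE; apply/idP/eqP => [/B1//|->].
  by have /fset0Pn[z zB] := ne _ Bs; rewrite -(B1 z).
case: s ne dis cov e => [_ _ /(_ 1%N)//|A [|B s]] _ dis _ e.
  by rewrite (e A)// mem_head.
move: dis => /= /andP[/andP[]].
rewrite (e A) ?mem_head// (e B) ?inE ?eqxx ?orbT// => /fdisjointP /(_ 1%N).
by rewrite !inE => /(_ isT).
Qed.

End ordered_partitions.

(** * Transition weights of the Gibbs chain and the support of its law *)

Section gibbs_law.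
Variables (R : realType) (d : measure_display) (T : measurableType d).
Variables (P : probability T R) (alpha : R) (V : nat -> nat -> R).
Variable Pi : nat -> T -> seq {fset nat}.
Hypotheses (alpha_lt1 : alpha < 1) (hPi : EGP P alpha V Pi).
Implicit Types (s : seq {fset nat}) (A : pred (seq {fset nat})).

Definition pr n A : R := fine (P [set w | A (Pi n w)]).

Definition state_event n s : set T := [set w | Pi n w = s].

(* When the state has probability 0 the quotient is 0 even if [V n (size s)]
   vanishes, so [state_mass] can be used without positivity assumptions. *)
Definition state_mass n s : R := fine (P (state_event n s)) / V n (size s).

Lemma measurable_pred n A : (0 < n)%N -> measurable [set w | A (Pi n w)].
Proof.
move=> n0; apply: (measurable_preimage_countable [set s | A s]).
by move=> s; exact: (EGP_measurable hPi).
Qed.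

Lemma measurable_state n s : (0 < n)%N -> measurable (state_event n s).
Proof. by move=> n0; exact: (EGP_measurable hPi). Qed.

Lemma denom_gt0 n k : (0 < k <= n)%N -> 0 < n%:R - alpha * k%:R.
Proof.
move=> /andP[k0 kn]; rewrite subr_gt0.
have k0' : 0 < k%:R :> R by rewrite ltr0n.
have kn' : k%:R <= n%:R :> R by rewrite ler_nat.
by rewrite (lt_le_trans _ kn')// gtr_pMl.
Qed.

Lemma V_ge0 n k : (0 < k <= n)%N -> 0 <= V n k.
Proof. by have [_ h _] := EGP_coefficients hPi; exact: h. Qed.

Lemma V_rec n k : (0 < k <= n)%N ->
  V n k = (n%:R - alpha * k%:R) * V n.+1 k + V n.+1 k.+1.
Proof. by have [_ _ h] := EGP_coefficients hPi; exact: h. Qed.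

Lemma sum_frequencies n s : tracked_partition n s ->
  \sum_(j < size s) ((nth 0%N (frequencies s) j)%:R - alpha) =
  n%:R - alpha * (size s)%:R.
Proof.
move=> ts; rewrite sumrB sumr_const card_ord mulr_natr; congr (_ - _).
rewrite -(tracked_sum ts) sumnE natr_sum (big_nth 0%N) big_mkord.
by rewrite size_frequencies.
Qed.

Lemma fine_prob_state_gt0 n s : (0 < n)%N -> fine (P (state_event n s)) != 0 ->
  (0 < P (state_event n s))%E.
Proof.
move=> n0 h; rewrite lt0e measure_ge0 andbT; apply: contra h => /eqP ->.
by rewrite eqxx.
Qed.

Lemma fine_cond_prob (B C : set T) : measurable B -> measurable C ->
  fine (P (B `&` C)) = cond_prob P B C * fine (P C).
Proof.
move=> mB mC; rewrite /cond_prob.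
have [e|ne] := eqVneq (fine (P C)) 0; last by rewrite divfK.
rewrite e mulr0; apply/eqP; rewrite eq_le fine_prob_ge0 andbT -e.
rewrite fine_le ?fin_num_measure//; first exact: measurableI.
by apply: le_measure; rewrite ?inE//; exact: measurableI.
Qed.

(** The recursion for [V] turns [1 - V_{n+1,k+1} / V_{n,k}] into
    [(n - alpha k) V_{n+1,k} / V_{n,k}], so the denominator of the joining probability cancels.
    Positivity of [V_{n,k}] is asked only at states that have mass. *)
Lemma transition n s A : (0 < n)%N -> tracked_partition n s ->
  (fine (P (state_event n s)) != 0 -> 0 < V n (size s)) ->
  fine (P (state_event n s `&` [set w | A (Pi n.+1 w)])) =
  state_mass n s * ((A (new_class s n.+1))%:R * V n.+1 (size s).+1 +
    \sum_(j < size s) (A (join_class s j n.+1))%:R *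
      (((nth 0%N (frequencies s) j)%:R - alpha) * V n.+1 (size s))).
Proof.
move=> n0 ts V0; rewrite /state_mass.
have [e|ne] := eqVneq (fine (P (state_event n s))) 0.
  rewrite e !mul0r setIC fine_cond_prob ?e ?mulr0//.
    exact: measurable_pred.
  exact: measurable_state.
have {V0} := V0 ne; set k := size s => V0.
have Pgt0 := fine_prob_state_gt0 n0 ne.
have kn := tracked_size ts.
set Ps := fine _ in ne *.
pose F c := fine (P (state_event n.+1 c `&` state_event n s)).
have FE c : F c = cond_prob P (state_event n.+1 c) (state_event n s) * Ps.
  by rewrite /F fine_cond_prob//; exact: measurable_state.
have Fnew : F (new_class s n.+1) = Ps / V n k * V n.+1 k.+1.
  rewrite FE (EGP_new hPi)//; ring.
have Fjoin j : (j < k)%N -> F (join_class s j n.+1) =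
    Ps / V n k * (((nth 0%N (frequencies s) j)%:R - alpha) * V n.+1 k).
  move=> jk; rewrite FE (EGP_join hPi)// (nth_map fset0)//.
  have := V_rec kn; rewrite -/k => e.
  have -> : V n.+1 k.+1 = V n k - (n%:R - alpha * k%:R) * V n.+1 k.
    by rewrite e addrC addKr.
  by field; rewrite !gt_eqF ?denom_gt0.
have sumF (B : pred (seq {fset nat})) : \sum_(c <- children n s | B c) F c =
    Ps / V n k * ((B (new_class s n.+1))%:R * V n.+1 k.+1 +
    \sum_(j < k) (B (join_class s j n.+1))%:R *
      (((nth 0%N (frequencies s) j)%:R - alpha) * V n.+1 k)).
  rewrite big_mkcond big_cons Fnew big_map -/k.
  have -> : iota 0 k = index_iota 0 k by rewrite /index_iota subn0.
  rewrite big_mkord mulrDr.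
  congr (_ + _).
    by case: (B _); rewrite ?mul1r// mul0r mulr0.
  rewrite mulr_sumr; apply: eq_bigr => j _; rewrite Fjoin//.
  by case: (B _); rewrite ?mul1r// mul0r mulr0.
(* The transition probabilities to the children of [s] sum to 1, so nothing
   is lost by restricting to them. *)
rewrite (@fine_prob_decomposition _ _ _ P _ (Pi n.+1) _ (children n s)
  (state_event n s)).
- rewrite -sumF [RHS]big_mkcond; apply: eq_bigr => c _.
  case: ifPn => Ac.
    rewrite setIA (_ : _ `&` _ `&` _ = state_event n.+1 c `&` state_event n s)//.
    apply/seteqP; split => w /=; first by case.
    by move=> [h1 h2]; split => //; rewrite h1.
  rewrite (_ : _ `&` _ = set0) ?measure0//.
  apply/seteqP; split => w //= -[h1 [h2 h3]].
  by rewrite -h1 h3 in Ac.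
- by move=> c; exact: measurable_state.
- exact: uniq_children ts.
- exact: measurable_state.
- by apply: measurableI; [exact: measurable_state|exact: measurable_pred].
- exact: subIsetl.
- rewrite (sumF xpredT) mul1r.
  under eq_bigr do rewrite mul1r.
  rewrite -mulr_suml (sum_frequencies ts) addrC -V_rec// divfK//.
  by rewrite gt_eqF.
Qed.

(** The two halves form one induction: the transition formula at the next step relies on positive
    coefficients at charged states. *)
Definition partitions_support m : Prop :=
  \sum_(s <- partitions m) fine (P (state_event m.+1 s)) = 1 /\
  forall s, s \in partitions m -> fine (P (state_event m.+1 s)) != 0 ->
    0 < V m.+1 (size s).

Lemma pr_step_support m A : partitions_support m -> pr m.+2 A =
  \sum_(s <- partitions m)
    state_mass m.+1 s * ((A (new_class s m.+2))%:R * V m.+2 (size s).+1 +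
    \sum_(j < size s) (A (join_class s j m.+2))%:R *
      (((nth 0%N (frequencies s) j)%:R - alpha) * V m.+2 (size s))).
Proof.
move=> [h1 h2]; rewrite /pr (@fine_prob_decomposition _ _ _ P _ (Pi m.+1) _
  (partitions m) setT)//.
- rewrite !big_seq; apply: eq_bigr => s sm; apply: transition => //.
    exact: partitions_tracked.
  exact: h2.
- by move=> s; exact: measurable_state.
- exact: uniq_partitions.
- exact: measurable_pred.
- under eq_bigr do rewrite setIT.
  by rewrite [LHS]h1 probability_setT.
Qed.

(** Mass passes on because the weights of the children of a state sum to its coefficient of [V]. A
    charged state [c] has a nonzero coefficient because every transition into [c] carries the factor
    [V m.+2 (size c)]. *)
Lemma partitions_supportP m : partitions_support m.
Proof.
elim: m => [|m ih].
  split=> [|s]; rewrite /= ?big_seq1.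
    rewrite -[RHS]/(fine 1%E) -(probability_setT P); congr (fine (P _)).
    apply/seteqP; split => w // _.
    exact/ordered_partition1/(EGP_partition hPi).
  by rewrite inE => /eqP ->; have [-> _ _] := EGP_coefficients hPi.
have [ih1 ih2] := ih.
split.
  pose A s := s \in partitions m.+1.
  transitivity (pr m.+2 A).
    rewrite /pr -(setIT [set w | _]) fine_prob_mem//.
    - by apply: eq_bigr => s _; rewrite setIT.
    - by move=> s; exact: measurable_state.
    - exact: uniq_partitions.
  rewrite pr_step_support// -[RHS]ih1 !big_seq; apply: eq_bigr => s sm.
  have ts := partitions_tracked sm.
  have childE c : c \in children m.+1 s -> A c = true.
    by move=> cs; rewrite /A /= mem_undup; apply/flatten_mapP; exists s.
  rewrite childE ?mem_head// mul1r.
  under eq_bigr => j _.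
    rewrite childE ?mul1r; last by apply/childrenP; right; exists j.
    over.
  rewrite -mulr_suml (sum_frequencies ts) addrC -V_rec ?(tracked_size ts)//.
  rewrite /state_mass; have [->|ne] := eqVneq (fine (P (state_event m.+1 s))) 0.
    by rewrite !mul0r.
  by rewrite divfK// gt_eqF// ih2.
move=> c cm; have tc := partitions_tracked cm.
have -> : fine (P (state_event m.+2 c)) = pr m.+2 (pred1 c).
  congr (fine (P _)); apply/seteqP; split => w /=; first by move=> ->; exact: eqxx.
  by move/eqP.
rewrite lt_neqAle V_ge0 ?(tracked_size tc)// andbT; apply: contra => /eqP/esym V0.
rewrite pr_step_support// big_seq big1// => s sm.
have ts := partitions_tracked sm.
suff -> : (pred1 c (new_class s m.+2))%:R * V m.+2 (size s).+1 +
    \sum_(j < size s) (pred1 c (join_class s j m.+2))%:R *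
      (((nth 0%N (frequencies s) j)%:R - alpha) * V m.+2 (size s)) = 0.
  by rewrite mulr0.
rewrite [X in X + _](_ : _ = 0) ?add0r; last first.
  rewrite /=; case: eqP => [e|]; last by rewrite mul0r.
  by rewrite -(size_rcons s [fset m.+2]%fset) [rcons _ _]e V0 mulr0.
apply: big1 => j _ /=; case: eqP => [e|]; last by rewrite mul0r.
have -> : V m.+2 (size s) = 0 by rewrite -V0 -e size_join_class.
by rewrite !mulr0.
Qed.

Lemma prE m A : pr m.+1 A =
  \sum_(s <- partitions m | A s) fine (P (state_event m.+1 s)).
Proof.
have [h1 _] := partitions_supportP m.
rewrite /pr (@fine_prob_decomposition _ _ _ P _ (Pi m.+1) _
  (partitions m) setT)//.
- rewrite [RHS]big_mkcond; apply: eq_bigr => s _; case: ifPn => As.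
    congr (fine (P _)); apply/seteqP; split => w /=; first by case.
    by move=> h; rewrite h.
  rewrite (_ : _ `&` _ = set0) ?measure0//.
  by apply/seteqP; split => w //= -[h1' h2']; rewrite -h1' h2' in As.
- by move=> s; exact: measurable_state.
- exact: uniq_partitions.
- exact: measurable_pred.
- under eq_bigr do rewrite setIT.
  by rewrite [LHS]h1 probability_setT.
Qed.

(** Serves to transfer the invariants of a reachable state, and the nonvanishing of [V], to a vector
    of positive probability. *)
Lemma pr_witness m A : pr m.+1 A != 0 ->
  exists s, [/\ A s, tracked_partition m.+1 s & 0 < V m.+1 (size s)].
Proof.
move=> h; have [e|] := eqVneq (\sum_(s <- partitions m | A s)
    fine (P (state_event m.+1 s))) 0; first by rewrite prE e eqxx in h.
have [/hasP[s sm /andP[As s0]] _|/hasPn no] :=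
    boolP (has (fun s => A s && (fine (P (state_event m.+1 s)) != 0)) (partitions m)).
  exists s; split=> //; first exact: partitions_tracked.
  by have [_] := partitions_supportP m; apply.
rewrite big_seq_cond big1 ?eqxx// => s /andP[sm As].
by have := no _ sm; rewrite As/= negbK => /eqP.
Qed.

(** * One-step recursions for record indices and frequencies *)

Lemma pr_step m A : pr m.+2 A =
  \sum_(s <- partitions m)
    state_mass m.+1 s * ((A (new_class s m.+2))%:R * V m.+2 (size s).+1 +
    \sum_(j < size s) (A (join_class s j m.+2))%:R *
      (((nth 0%N (frequencies s) j)%:R - alpha) * V m.+2 (size s))).
Proof. exact/pr_step_support/partitions_supportP. Qed.

(** Earlier records are at most [m.+1], so only opening a class produces the record [m.+2]. The free
    test [B] serves both the record law and the joint law. *)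
Lemma pr_new m i (B : pred (seq nat)) :
  pr m.+2 (fun s => (record_indices s == rcons i m.+2) && B (frequencies s)) =
  V m.+2 (size i).+1 / V m.+1 (size i) *
  pr m.+1 (fun s => (record_indices s == i) && B (rcons (frequencies s) 1%N)).
Proof.
rewrite pr_step prE mulr_sumr [RHS]big_mkcond/= !big_seq.
apply: eq_bigr => s /partitions_tracked ts.
rewrite [X in _ + X]big1 ?addr0; last first.
  move=> j _; rewrite (record_indices_join_class ts)//.
  case: eqP => [e|_]; last by rewrite mul0r.
  by have := tracked_last ts; rewrite e last_rcons ltnn.
rewrite record_indices_new_class frequencies_new_class eqseq_rcons eqxx andbT.
case: eqP => [<-|_] /=; last by rewrite mul0r mulr0.
rewrite size_record_indices /state_mass; case: (B _); last by rewrite mul0r mulr0.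
by rewrite mul1r mulrC mulrA mulrAC.
Qed.

(** The move must be a join. Its weight depends on the frequencies of the parent, so the sum over
    parents remains for a general [B]. *)
Lemma pr_join m i (B : pred (seq nat)) : (last 0%N i <= m.+1)%N ->
  pr m.+2 (fun s => (record_indices s == i) && B (frequencies s)) =
  V m.+2 (size i) / V m.+1 (size i) *
  \sum_(s <- partitions m | record_indices s == i)
    (fine (P (state_event m.+1 s)) *
     \sum_(j < size i) (B (incr_nth (frequencies s) j))%:R *
       ((nth 0%N (frequencies s) j)%:R - alpha)).
Proof.
move=> li; rewrite pr_step mulr_sumr [RHS]big_mkcond/= !big_seq.
apply: eq_bigr => s /partitions_tracked ts.
rewrite record_indices_new_class [X in X + _](_ : _ = 0) ?add0r; last first.
  case: eqP => [e|_]; last by rewrite mul0r.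
  by move: li; rewrite -e last_rcons ltnn.
under eq_bigr => j _.
  rewrite (record_indices_join_class ts)// (frequencies_join_class ts)//.
  over.
case: eqP => [ri|_] /=; last first.
  by rewrite big1 ?mulr0// => j _; rewrite mul0r.
rewrite /state_mass -[in size i]ri size_record_indices.
under eq_bigr do rewrite mulrA.
by rewrite -mulr_suml; ring.
Qed.

Lemma pr_record_new m i :
  pr m.+2 (fun s => record_indices s == rcons i m.+2) =
  V m.+2 (size i).+1 / V m.+1 (size i) * pr m.+1 (fun s => record_indices s == i).
Proof.
transitivity (pr m.+2 (fun s => (record_indices s == rcons i m.+2) && true)).
  by congr pr; apply/funext => s; rewrite andbT.
rewrite (pr_new m i xpredT).
by congr (_ * pr _ _); apply/funext => s; rewrite andbT.
Qed.

(** The joining weights have the same sum for every parent with records [i], so the frequencies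
    disappear. *)
Lemma pr_record_join m i : (last 0%N i <= m.+1)%N ->
  pr m.+2 (fun s => record_indices s == i) =
  (m.+1%:R - alpha * (size i)%:R) * V m.+2 (size i) / V m.+1 (size i) *
  pr m.+1 (fun s => record_indices s == i).
Proof.
move=> li.
transitivity (pr m.+2 (fun s => (record_indices s == i) && true)).
  by congr pr; apply/funext => s; rewrite andbT.
rewrite (@pr_join m i xpredT)// prE.
have rearrange (a b c x : R) : a * b / c * x = b / c * (a * x) by ring.
rewrite rearrange; congr (_ * _).
rewrite mulr_sumr big_seq_cond [RHS]big_seq_cond.
apply: eq_bigr => s /andP[/partitions_tracked ts /eqP ri].
under eq_bigr do rewrite mul1r.
by rewrite mulrC -ri size_record_indices (sum_frequencies ts).
Qed.

(** Joining class [j] ends in [nn] exactly from [decr j nn], where that class has size [n_j - 1].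
    For [n_j = 0] there is no such parent although [decr j nn] is still a vector, hence the test. *)
Lemma pr_frequencies_join m i nn : (last 0%N i <= m.+1)%N -> size nn = size i ->
  pr m.+2 (fun s => (record_indices s == i) && (frequencies s == nn)) =
  V m.+2 (size i) / V m.+1 (size i) *
  \sum_(j < size i) ((nth 0%N nn j)%:R - 1 - alpha) *
    (if (0 < nth 0%N nn j)%N
     then pr m.+1 (fun s => (record_indices s == i) && (frequencies s == decr j nn))
     else 0).
Proof.
move=> li sn; rewrite (@pr_join m i (pred1 nn))//; congr (_ * _).
under eq_bigr do rewrite mulr_sumr.
rewrite exchange_big/=; apply: eq_bigr => j _.
have jn : (j < size nn)%N by rewrite sn.
case: ifPn => [nj|]; last first.
  rewrite -eqn0Ngt => /eqP nj; rewrite mulr0; apply: big1 => s _.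
  case: eqP => [e|_]; last by rewrite !(mul0r, mulr0).
  by move: nj; rewrite -e nth_incr_nth eqxx.
rewrite prE mulr_sumr big_mkcond [RHS]big_mkcond/= !big_seq.
apply: eq_bigr => s /partitions_tracked ts.
case: eqP => [ri|//] /=.
have sf : size (frequencies s) = size nn.
  by rewrite size_frequencies -size_record_indices ri.
have -> : (incr_nth (frequencies s) j == nn) = (frequencies s == decr j nn).
  apply/eqP/eqP => [<-|->].
    apply: (@eq_from_nth _ 0%N) => [|l ls].
      by rewrite size_decr size_incr_nth sf jn.
    rewrite /decr nth_set_nth/= !nth_incr_nth eqxx.
    by case: eqP => [->//|/nesym/eqP/negbTE ->].
  apply: (@eq_from_nth _ 0%N) => [|l ls].
    by rewrite size_incr_nth size_decr// jn.
  rewrite nth_incr_nth /decr nth_set_nth/= eq_sym.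
  by case: eqP => [->|//]; rewrite add1n prednK.
case: eqP => [e|_]; last by rewrite mul0r mulr0.
rewrite mul1r mulrC e /decr nth_set_nth/= eqxx.
by rewrite -{2}(prednK nj) -natr1 addrK.
Qed.

(** * Closed forms of the record law and of the joint law *)

Lemma psi_succ n k i : (0 < k <= n)%N ->
  (n%:R - alpha * k%:R) * psi alpha n.+1 k i = psi alpha n k i.
Proof.
move=> kn; have D0 := denom_gt0 kn; rewrite /psi mulrA; congr (_ * _).
rewrite -natr1 addrAC GammaD1//.
by field; rewrite !gt_eqF ?Gamma_gt0.
Qed.

(** The numerator of the added factor cancels the new prefactor and its denominator restores the old
    one; only steps without a record change [psi]. *)
Lemma psi_rcons n i : (0 < size i <= n)%N ->
  psi alpha n.+1 (size i).+1 (rcons i n.+1) = psi alpha n (size i) i.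
Proof.
move=> kn; have /andP[k0 _] := kn; have D0 := denom_gt0 kn; rewrite /psi big_nat_recr//=.
rewrite [X in _ * (X * _)](_ : _ = \prod_(2 <= j < (size i).+1)
    (Gamma ((entry i j)%:R - j%:R * alpha) /
     Gamma ((entry i j)%:R - j%:R * alpha - (1 - alpha)))); last first.
  rewrite !big_nat; apply: eq_bigr => j /andP[j2 jk].
  by rewrite /entry nth_rcons prednK ?(ltnW j2)// -ltnS jk.
rewrite [entry _ _]/entry/= nth_rcons ltnn eqxx.
have -> : n.+1%:R - (size i).+1%:R * alpha - (1 - alpha) =
  n%:R - alpha * (size i)%:R :> R by rewrite -!natr1; ring.
rewrite [_.+1%:R * alpha]mulrC.
have D1 : 0 < n.+1%:R - alpha * (size i).+1%:R.
  by apply: denom_gt0; rewrite /= ltnS; case/andP: kn.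
have := Gamma_gt0 D0; have := Gamma_gt0 D1.
move: (Gamma _) (Gamma (n%:R - _)) (Gamma _) (\prod_(_ <= _ < _) _) => b c a p b0 c0.
by field; rewrite !gt_eqF.
Qed.

(** Induction according to whether the newest element is a record. Positive probability of the
    earlier records makes the earlier coefficient nonzero, so the ratios of [V] telescope. *)
Lemma record_law m i : pr m.+1 (fun s => record_indices s == i) != 0 ->
  pr m.+1 (fun s => record_indices s == i) * psi alpha m.+1 (size i) i =
  V m.+1 (size i).
Proof.
elim: m i => [|m ih] i h.
  have [s [/eqP ri ts _]] := pr_witness h; move: h.
  rewrite !prE /= !big_mkcond !big_seq1/= /record_indices/= least_fset1.
  case: ([:: 1%N] =P i) => [<- _|]; last by rewrite eqxx.
  have [+ _] := partitions_supportP 0; rewrite /= big_seq1 => ->.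
  have [-> _ _] := EGP_coefficients hPi.
  rewrite mul1r /psi big_geq// mulr1 mulr1 divff// gt_eqF// Gamma_gt0//.
  by rewrite subr_gt0.
have [s [/eqP ri ts V0]] := pr_witness h.
case/lastP: i h ri => [|i x] h ri.
  by have := tracked_size ts; rewrite -size_record_indices ri.
have := tracked_last ts; rewrite ri last_rcons leq_eqVlt => /predU1P[xm|xm].
  move: h; rewrite xm pr_record_new mulf_eq0 negb_or => /andP[Vn h].
  have [s' [/eqP ri' ts' V0']] := pr_witness h.
  have sizei : (0 < size i <= m.+1)%N.
    by rewrite -ri' size_record_indices (tracked_size ts').
  have Vi : V m.+1 (size i) != 0 by rewrite -ri' size_record_indices gt_eqF.
  by rewrite size_rcons psi_rcons// -mulrA ih// divfK.
have li : (last 0%N (rcons i x) <= m.+1)%N by rewrite last_rcons.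
move: h; rewrite pr_record_join// mulf_eq0 negb_or => /andP[Vn h].
have [s' [/eqP ri' ts' V0']] := pr_witness h.
have sizei : (0 < size (rcons i x) <= m.+1)%N.
  by rewrite -ri' size_record_indices (tracked_size ts').
have Vi : V m.+1 (size (rcons i x)) != 0 by rewrite -ri' size_record_indices gt_eqF.
have rearrange (a b c p q : R) : a * b / c * p * q = b / c * (p * (a * q)) by ring.
by rewrite rearrange psi_succ// ih// divfK.
Qed.

(** Incompatible vectors of the right length and total are included, with weight 0, because
    decrementing a compatible vector can produce them. *)
Lemma frequency_law m i nn : pr m.+1 (fun s => record_indices s == i) != 0 ->
  size nn = size i -> sumn nn = m.+1 ->
  pr m.+1 (fun s => (record_indices s == i) && (frequencies s == nn)) =
  V m.+1 (size i) * freq_weight alpha i nn.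
Proof.
elim: m i nn => [|m ih] i nn h sn sumnn.
  have [s [/eqP ri ts _]] := pr_witness h; move: h.
  rewrite !prE /= !big_mkcond !big_seq1/= /record_indices/= least_fset1.
  case: ([:: 1%N] =P i) => [ei _|]; last by rewrite eqxx.
  rewrite -ei /= in sn *.
  case: nn sn sumnn => [|y [|]]//= _; rewrite addn0 => ->.
  rewrite big_mkcond big_seq1 /record_indices /frequencies/=.
  rewrite least_fset1 cardfs1 eqxx.
  have [+ _] := partitions_supportP 0; rewrite /= big_seq1 => ->.
  have [-> _ _] := EGP_coefficients hPi.
  rewrite /freq_weight big_ord_recl big_ord0 /class_weight/= /rise big_ord0.
  by rewrite bin0 !mulr1.
have [s [/eqP ri ts V0]] := pr_witness h.
case/lastP: i h ri sn => [|i x] h ri.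
  by have := tracked_size ts; rewrite -size_record_indices ri.
have := tracked_last ts; rewrite ri last_rcons leq_eqVlt => /predU1P[xm|xm] sn.
  move: h; rewrite xm pr_record_new mulf_eq0 negb_or => /andP[Vn h].
  have [s' [/eqP ri' ts' V0']] := pr_witness h.
  have Vi : V m.+1 (size i) != 0 by rewrite -ri' size_record_indices gt_eqF.
  case/lastP: nn sn sumnn => [|nn y]; first by rewrite size_rcons.
  rewrite !size_rcons => -[sn]; rewrite sumn_rcons => sumnn.
  rewrite (@pr_new m i (pred1 (rcons nn y))) freq_weight_rcons//.
  (* The class opened by [m.+2] is a singleton. Otherwise [y] is 0, or the older total is too small
     for the record [m.+2], and both sides vanish. *)
  have [y1|y1] := eqVneq y 1%N.
    rewrite y1 addn1 in sumnn *; case: sumnn => sumnn.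
    have -> : pr m.+1 (fun s => (record_indices s == i) &&
        pred1 (rcons nn 1%N) (rcons (frequencies s) 1%N)) =
      pr m.+1 (fun s => (record_indices s == i) && (frequencies s == nn)).
      by congr pr; apply/funext => t; rewrite /= eqseq_rcons eqxx andbT.
    rewrite ih// sumnn /class_weight /= leqnn addn1 subnn bin0 /rise big_ord0.
    by rewrite !mulr1 mulrA divfK.
  rewrite (_ : class_weight _ _ _ _ = 0); last first.
    rewrite /class_weight ifF//; apply/negbTE; lia.
  rewrite mulr0 mulr0 prE big1 ?mulr0// => t /andP[_].
  by rewrite /= eqseq_rcons eq_sym [1%N == _]eq_sym (negbTE y1) andbF.
have li : (last 0%N (rcons i x) <= m.+1)%N by rewrite last_rcons.
rewrite pr_frequencies_join//.
move: h; rewrite pr_record_join// mulf_eq0 negb_or => /andP[Vn h].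
set I := rcons i x in ri h sn li *.
have [s' [/eqP ri' ts' V0']] := pr_witness h.
have Vi : V m.+1 (size I) != 0 by rewrite -ri' size_record_indices gt_eqF.
have pathI : path ltn 0%N I by rewrite -ri' (tracked_path ts').
rewrite -[in RHS](@freq_weight_decr _ alpha I nn)//; last by rewrite sumnn ltnS.
rewrite sn !mulr_sumr; apply: eq_bigr => j _.
have jn : (j < size nn)%N by rewrite sn.
case: ifPn => nj.
  rewrite ih ?size_decr ?sumn_decr ?sumnn//; by field.
rewrite (@freq_weight_nth0 _ _ _ _ j) ?mulr0//.
move: nj; rewrite -eqn0Ngt => /eqP nj.
by rewrite /decr nth_set_nth/= eqxx nj.
Qed.

End gibbs_law.

(** * Identification with [mu_bar] and conditioning on the records *)

Lemma psumE (s : seq nat) j : psum s j = sumn (take j s).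
Proof.
elim: j => [|j ih]; first by rewrite take0 /psum big_geq.
rewrite /psum big_nat_recr//= -/(psum s j) ih /entry/=.
have [js|sj] := ltnP j (size s); first by rewrite (take_nth 0%N)// sumn_rcons.
by rewrite nth_default// addn0 !take_oversize// ltnW.
Qed.

Lemma mu_bar_weight (R : realType) (alpha : R) n i nn : alpha < 1 ->
  compatible n i nn ->
  mu_bar alpha n nn i = psi alpha n (size i) i * freq_weight alpha i nn.
Proof.
move=> alpha1 [sn nn0 _ cp]; rewrite /mu_bar; congr (_ * _).
rewrite big_add1 big_mkord; apply: eq_bigr => j _.
have jr : (1 <= j.+1 <= size i)%N by rewrite ltn_ord.
have := nn0 _ jr; have := cp _ jr; rewrite !psumE /entry /= => h1 h2.
rewrite (take_nth 0%N) ?sn// sumn_rcons risingE ?subr_gt0//.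
by rewrite leq_subLR add1n in h1; rewrite /class_weight h1 h2 !subn1.
Qed.

(** A nonzero product makes every class pass the test in [class_weight], and with the given length
    and total these tests amount to compatibility. *)
Lemma incompatible_weight (R : realType) (alpha : R) n i nn :
  size nn = size i -> sumn nn = n -> ~ compatible n i nn ->
  freq_weight alpha i nn = 0.
Proof.
move=> sn sumnn nc; apply/eqP; rewrite /freq_weight.
apply/negPn/negP => /prodf_neq0 h; apply: nc.
have hw j : (1 <= j <= size i)%N ->
    ((0 < nth 0 nn j.-1) && (nth 0 i j.-1 <= (sumn (take j.-1 nn)).+1))%N.
  case: j => // j ji; have := h (Ordinal (ji : (j < size i)%N)) isT.
  by rewrite /class_weight/=; case: ifP; rewrite ?eqxx.
split=> //.
- by move=> j /hw/andP[].
- by rewrite psumE -sn take_size.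
- by move=> j /hw/andP[_]; rewrite psumE /entry leq_subLR add1n.
Qed.

Theorem proposition2 (R : realType) (d : measure_display)
    (T : measurableType d) (P : probability T R)
    (alpha : R) (halpha : alpha < 1) (V : nat -> nat -> R)
    (Pi : nat -> T -> seq {fset nat}) (hPi : EGP P alpha V Pi)
    (n : nat) (hn : (1 <= n)%N) (i : seq nat)
    (hi : (0 < P [set w | record_indices (Pi n w) = i])%E) (nn : seq nat) :
  (compatible n i nn ->
     cond_prob P [set w | frequencies (Pi n w) = nn]
                 [set w | record_indices (Pi n w) = i]
     = mu_bar alpha n nn i) /\
  (~ compatible n i nn ->
     cond_prob P [set w | frequencies (Pi n w) = nn]
                 [set w | record_indices (Pi n w) = i]
     = 0).
Proof.
case: n hn hi => [//|m] _ hi.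
set rec := fun s => record_indices s == i.
have recE : [set w | record_indices (Pi m.+1 w) = i] = [set w | rec (Pi m.+1 w)].
  by apply/seteqP; split => w /eqP.
have jointE : [set w | frequencies (Pi m.+1 w) = nn] `&`
    [set w | record_indices (Pi m.+1 w) = i] =
    [set w | rec (Pi m.+1 w) && (frequencies (Pi m.+1 w) == nn)].
  apply/seteqP; split => w /=; first by move=> [-> ri]; rewrite /rec ri !eqxx.
  by move=> /andP[/eqP ri /eqP].
have recN0 : pr P Pi m.+1 rec != 0.
  rewrite gt_eqF// fine_gt0// -recE hi/= ltey_eq fin_num_measure// recE.
  exact: (measurable_pred hPi).
have -> : cond_prob P [set w | frequencies (Pi m.+1 w) = nn]
    [set w | record_indices (Pi m.+1 w) = i] =
  pr P Pi m.+1 (fun s => (record_indices s == i) && (frequencies s == nn)) /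
  pr P Pi m.+1 rec by rewrite /cond_prob jointE recE.
have law := frequency_law halpha hPi recN0.
split=> [c|nc].
  have [sn _ ps _] := c; have sumnn : sumn nn = m.+1 by rewrite -ps psumE -sn take_size.
  rewrite (mu_bar_weight halpha c) (law nn sn sumnn).
  (* Writing the coefficient of [V] as the record probability times [psi] lets the conditioning
     divide it out, so the result is independent of [V]. *)
  by rewrite -(record_law halpha hPi recN0); field.
apply/eqP; rewrite mulf_eq0; apply/orP; left; apply/eqP.
(* The joint law does not cover a wrong length or total; such a vector has probability 0, since a
   reachable state realizing it would have the right ones. *)
have [[sn sumnn]|bad] := pselect (size nn = size i /\ sumn nn = m.+1).
  by rewrite (law nn sn sumnn) (incompatible_weight _ sn sumnn nc) mulr0.
apply/eqP; apply/negPn/negP => /(pr_witness halpha hPi) [s [/andP[/eqP rs /eqP fs] ts _]].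
apply: bad; rewrite -fs -rs size_frequencies size_record_indices.
by rewrite (tracked_sum ts).
Qed.
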